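(* Let $X$ be a finite alphabet with $|X|>1$, and let $G_0$ be the group of all automata transformations $g$ over $X$ such that $NS(g,l)=o(|X|^l)$ as $l\to\infty$, acting on the set $X^w$ of infinite words over $X$. Then $X^w$ is not $G_0$-paradoxical.
   Context: $X$ is a fixed finite alphabet with $|X|>1$; $X^*$ is the set of finite words over $X$ (including the empty word $\emptyset$), $X^l$ the set of words of length $l$, and $X^w$ the set of infinite words $x_1x_2\ldots$ with $x_i\in X$. An automaton $A=(X,Q,\pi,\lambda)$ consists of the alphabet $X$, a (possibly infinite) set of states $Q$, a transition function $\pi:Q\times X\to Q$ and an output function $\lambda:Q\times X\to X$. These are extended to words by $\pi(q,\emptyset)=q$, $\pi(q,xv)=\pi(\pi(q,x),v)$, $\lambda(q,\emptyset)=\emptyset$, $\lambda(q,xv)=\lambda(q,x)\lambda(\pi(q,x),v)$ for $x\in X$, $v\in X^*$; $\lambda(q,\cdot)$ is extended in the same way to $X^w$. All automata are assumed invertible: for each $q\in Q$ the map $\lambda(q,\cdot)$ is a bijection of $X$. An automata transformation is a map $g=\lambda(q,\cdot)$ defined by an automaton with a fixed state $q$ (an initial automaton $A_q$); it acts bijectively on each $X^l$, on $X^*$ and on $X^w$. A state is trivial if it defines the identity transformation. A word $v\in X^*$ moves $g=\lambda(q,\cdot)$ to the trivial state if $\pi(q,v)$ is a trivial state (this depends only on $g$ and $v$). $NS(g,l)$ denotes the number of words in $X^l$ that move $g$ to a non-trivial state. The set $G_0$ of automata transformations $g$ with $NS(g,l)=o(|X|^l)$, $l\to\infty$, is a group under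 composition. For a group $G$ acting on a set $Y$, a subset $E\subseteq Y$ is $G$-paradoxical if for some positive integers $m,n$ there are pairwise disjoint subsets $A_1,\dots,A_n,B_1,\dots,B_m$ of $E$ and elements $g_1,\dots,g_n,h_1,\dots,h_m\in G$ such that $E=\bigcup_{i=1}^n g_i(A_i)=\bigcup_{j=1}^m h_j(B_j)$. *)

(* Defs.v *)
From HB Require Import structures.
From mathcomp Require Import all_boot all_order all_algebra.
From mathcomp Require Import boolp classical_sets reals topology normedtype.
From mathcomp Require Import landau sequences.

Set Implicit Arguments.
Unset Strict Implicit.
Unset Printing Implicit Defensive.

Import Order.TTheory GRing.Theory Num.Theory.
Import numFieldNormedType.Exports.

Local Open Scope classical_set_scope.
Local Open Scope ring_scope.

Record automaton (X : finType) := Automaton {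
  state : Type;
  trans : state -> X -> state;
  out : state -> X -> X;
  out_bij : forall q, bijective (out q) }.

Section Automata.
Variables (X : finType) (A : automaton X).
Implicit Types (q : state A) (v : seq X) (w : nat -> X).

Definition trans_word q v : state A := foldl (@trans X A) q v.

Fixpoint out_word q v : seq X :=
  if v is x :: v' then out q x :: out_word (trans q x) v' else [::].

(* Infinite words x_0 x_1 ... are functions nat -> X; the n-th output letter is
   produced in the state reached after reading the prefix of length n. *)
Definition out_inf q w : nat -> X :=
  fun n => out (trans_word q (mkseq w n)) (w n).

Definition trivial_state q : Prop := forall v, out_word q v = v.

(* NS(g, l) for g = out_inf q; NS_transformation below shows that this number
   depends only on g. *)
Definition NS q (l : nat) : nat :=
  #|[set v : l.-tuple X | ~~ `[< trivial_state (trans_word q v) >]]%SET|.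

Lemma out_word_cat q u v :
  out_word q (u ++ v) = out_word q u ++ out_word (trans_word q u) v.
Proof. by elim: u q => [|x u IH] q //=; rewrite IH. Qed.

Lemma size_out_word q v : size (out_word q v) = size v.
Proof. by elim: v q => [|x v IH] q //=; rewrite IH. Qed.

Lemma out_word_inj q : injective (out_word q).
Proof.
move=> u v; elim: u v q => [|x u IH] [|y v] q //= [/(bij_inj (out_bij q)) <-].
by move=> /IH ->.
Qed.

Lemma mkseq_out_inf q w n : mkseq (out_inf q w) n = out_word q (mkseq w n).
Proof. by elim: n => [|n IH] //; rewrite !mkseqS IH -!cats1 out_word_cat. Qed.

Definition out_tuple q l (v : l.-tuple X) : l.-tuple X :=
  @Tuple l X (out_word q v) (introT eqP (etrans (size_out_word q v) (size_tuple v))).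

Lemma out_tuple_inj q l : injective (@out_tuple q l).
Proof. by move=> u v /(congr1 val) /= /out_word_inj /val_inj. Qed.

End Automata.

Lemma out_inf_word (X : finType) (A B : automaton X) (q : state A) (p : state B) :
  out_inf q = out_inf p -> out_word q =1 out_word p.
Proof.
move=> qp [|x v] //; set w := nth x (x :: v).
have <- : mkseq w (size v).+1 = x :: v by exact: (mkseq_nth x (x :: v)).
by rewrite -!mkseq_out_inf qp.
Qed.

Lemma NS_transformation (X : finType) (A B : automaton X) (q : state A) (p : state B) :
  out_inf q = out_inf p -> NS q =1 NS p.
Proof.
move=> /out_inf_word qp l; apply: eq_card => v; rewrite !inE; congr (~~ _).
apply: asbool_equiv_eq; split=> tr u; rewrite -{2}(tr u).
  have := qp (v ++ u); rewrite !out_word_cat => /(congr1 (drop (size v))).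
  by rewrite !drop_size_cat ?size_out_word.
have := qp (v ++ u); rewrite !out_word_cat => /(congr1 (drop (size v))).
by rewrite !drop_size_cat ?size_out_word.
Qed.

Definition G0_set (R : realType) (X : finType) : set ((nat -> X) -> (nat -> X)) :=
  [set g | exists (A : automaton X) (q : state A),
     g = out_inf q /\
     (fun l : nat => (NS q l)%:R : R^o) =o_\oo
     (fun l : nat => #|X|%:R ^+ l : R^o)].

(* A group acting (faithfully) on Y, given as a set of maps Y -> Y. *)
Definition is_transformation_group (Y : Type) (G : set (Y -> Y)) : Prop :=
  [/\ G id,
      forall g h, G g -> G h -> G (g \o h)
    & forall g, G g -> exists2 h, G h & cancel g h /\ cancel h g].

Record transformation_group (Y : Type) := TransformationGroup {
  tg_set :> set (Y -> Y);
  tg_axiom : is_transformation_group tg_set }.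

Section Group.
Variable X : finType.

Lemma id_out_bij (_ : unit) : bijective (@id X). Proof. by exists id. Qed.
Definition id_automaton := @Automaton X unit (fun q _ => q) (fun _ x => x) id_out_bij.

Lemma id_trivial (q : state id_automaton) : trivial_state q.
Proof. by elim=> [|x v IH] //=; rewrite IH. Qed.

Section Comp.
Variables A B : automaton X.

Lemma comp_out_bij (s : state A * state B) : bijective (out s.1 \o out s.2).
Proof. exact: bij_comp (out_bij _) (out_bij _). Qed.

Definition comp_automaton := @Automaton X (state A * state B)
  (fun s x => (trans s.1 (out s.2 x), trans s.2 x))
  (fun s => out s.1 \o out s.2) comp_out_bij.

Lemma comp_trans_word (s : state comp_automaton) v :
  trans_word s v = (trans_word s.1 (out_word s.2 v), trans_word s.2 v).
Proof. by elim: v s => [|x v IH] [q p] //; rewrite /= -(IH (_, _)). Qed.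

Lemma comp_out_word (s : state comp_automaton) v :
  out_word s v = out_word s.1 (out_word s.2 v).
Proof. by elim: v s => [|x v IH] [q p] //=; rewrite IH. Qed.

Lemma comp_out_inf (s : state comp_automaton) :
  out_inf s = out_inf s.1 \o out_inf s.2.
Proof.
by apply/funext => w; apply/funext => n; rewrite /out_inf/= comp_trans_word -mkseq_out_inf.
Qed.

Lemma comp_NS (s : state comp_automaton) l : (NS s l <= NS s.1 l + NS s.2 l)%N.
Proof.
rewrite /NS; set S := finset _; set S1 := finset _; set S2 := finset _.
rewrite -(card_preimset S1 (@out_tuple_inj _ _ s.2 l)).
apply: (@leq_trans #|(@out_tuple _ _ s.2 l @^-1: S1) :|: S2|); last first.
  by rewrite cardsU leq_subr.
apply/subset_leq_card/fintype.subsetP => v; rewrite !inE -negb_and; apply: contra.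
case/andP => /asboolP t1 /asboolP t2; apply/asboolP => u.
by rewrite comp_out_word comp_trans_word /= t2 t1.
Qed.
End Comp.

Section Inv.
Variable A : automaton X.

Definition inv_out (q : state A) : X -> X := invF (bij_inj (out_bij q)).

Lemma inv_out_bij q : bijective (inv_out q).
Proof. by exists (out q); [exact: f_invF|exact: invF_f]. Qed.

Definition inv_automaton := @Automaton X (state A)
  (fun q x => trans q (inv_out q x)) inv_out inv_out_bij.

Implicit Type q : state A.
Let inv q : state inv_automaton := q.

Lemma out_wordK q : cancel (out_word q) (out_word (inv q)).
Proof. by move=> v; elim: v q => [|x v IH] q //=; rewrite /inv_out invF_f IH. Qed.

Lemma inv_out_wordK q : cancel (out_word (inv q)) (out_word q).
Proof. by move=> v; elim: v q => [|x v IH] q //=; rewrite /inv_out f_invF IH. Qed.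

Lemma inv_trans_word q v : trans_word (inv q) (out_word q v) = trans_word q v.
Proof.
elim: v q => [|x v IH] q //=; rewrite /trans_word/= /inv_out invF_f.
exact: IH.
Qed.

Lemma inv_trivial q : trivial_state (inv q) <-> trivial_state q.
Proof.
split=> tr v; first by rewrite -[LHS]tr out_wordK.
by rewrite -[LHS]tr inv_out_wordK.
Qed.

Lemma out_infK q : cancel (out_inf q) (out_inf (inv q)).
Proof.
move=> w; apply/funext => n; rewrite {1}/out_inf mkseq_out_inf inv_trans_word.
exact: invF_f.
Qed.

Lemma inv_out_infK q : cancel (out_inf (inv q)) (out_inf q).
Proof.
move=> w; apply/funext => n; rewrite {1}/out_inf mkseq_out_inf.
by rewrite -inv_trans_word inv_out_wordK; exact: f_invF.
Qed.

Lemma inv_NS q l : NS (inv q) l = NS q l.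
Proof.
rewrite /NS -(card_preimset _ (@out_tuple_inj _ _ q l)).
apply: eq_card => v; rewrite !inE; congr (~~ _); apply: asbool_equiv_eq.
by rewrite inv_trans_word; exact: inv_trivial.
Qed.
End Inv.

Lemma G0_is_group (R : realType) : is_transformation_group (@G0_set R X).
Proof.
split.
- exists id_automaton, tt; split; first by apply/funext => w; apply/funext.
  apply/eqoP => e e0; near=> l; rewrite (_ : NS _ _ = 0%N) ?normr0.
    by apply: mulr_ge0 => //; exact: ltW.
  apply: eq_card0 => v; rewrite !inE; apply/negbF/asboolP; exact: id_trivial.
- move=> _ _ [A [q [-> oq]]] [B [p [-> op]]].
  exists (comp_automaton A B), (q, p); split; first by rewrite comp_out_inf.
  move/eqoP: oq => oq; move/eqoP: op => op.
  apply/eqoP => e e0; have e2 : 0 < e / 2 by rewrite divr_gt0.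
  near=> l; rewrite [e]splitr mulrDl.
  apply: (@le_trans _ _ (`|(NS q l)%:R : R^o| + `|(NS p l)%:R : R^o|)).
    by rewrite !normr_nat -natrD ler_nat; exact: (comp_NS (q, p)).
  by apply: lerD; near: l; [exact: oq|exact: op].
- move=> _ [A [q [-> oq]]]; exists (@out_inf X (inv_automaton A) q).
    exists (inv_automaton A), q; split=> //.
    by rewrite (_ : (fun l => _) = (fun l => (NS q l)%:R)) //;
       apply/funext => l; rewrite inv_NS.
  by split; [exact: out_infK|exact: inv_out_infK].
Unshelve. all: by end_near. Qed.

End Group.

Definition G0 (R : realType) (X : finType) : transformation_group (nat -> X) :=
  TransformationGroup (G0_is_group X R).

Definition paradoxical (Y : Type) (G : transformation_group Y) (E : set Y) : Prop :=
  exists (n m : nat) (A : 'I_n -> set Y) (B : 'I_m -> set Y)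
         (g : 'I_n -> Y -> Y) (h : 'I_m -> Y -> Y),
    [/\ (0 < n)%N /\ (0 < m)%N,
        (forall i, A i `<=` E) /\ (forall j, B j `<=` E),
        [/\ trivIset setT A, trivIset setT B
          & forall i j, A i `&` B j = set0],
        (forall i, tg_set G (g i)) /\ (forall j, tg_set G (h j))
      & E = \bigcup_i (g i @` A i) /\ E = \bigcup_j (h j @` B j)].

(* Main.v *)
Require Import Defs.
From HB Require Import structures.
From mathcomp Require Import all_boot all_order all_algebra.
From mathcomp Require Import boolp classical_sets reals topology normedtype.
From mathcomp Require Import landau sequences.

(** The group [G0] satisfies a Foelner condition on the space of infinite words.
Fix a letter [x0] and let [F_l] be the set of the words [u x0 x0 x0 ...] with
[u] of length [l]. If [u] moves [g] to a trivial state, then [g] copies the tail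
[x0 x0 ...] unchanged, so [g] sends [u x0 x0 ...] back into [F_l]; hence at most
[NS(g, l) = o(#|F_l|)] points of [F_l] leave [F_l] under [g]
([card_escape_le_NS]). For finitely many elements of [G0], all these escaping
points together are thus fewer than [#|F_l|] once [l] is large ([G0_Foelner]).

Such sets rule out paradoxical decompositions ([Foelner_not_paradoxical]):
pulling the points of [F] back through the two coverings, by the inverses of the
[g i] and of the [h j], gives [2 #|F|] distinct points, since all the pieces are
disjoint. At most [#|F|] of them lie in [F], and fewer than [#|F|] are outside
because each of those comes from an escaping point. *)

Import Order.TTheory GRing.Theory Num.Theory.
Import numFieldNormedType.Exports.

Local Open Scope classical_set_scope.
Local Open Scope ring_scope.

(** Finite subsets of [Y] are given by an injective enumeration [p : T -> Y], so
that their points can be counted as elements of a finite type. *)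
Definition escape {Y : Type} {T : finType} (p : T -> Y) (f : Y -> Y) : {set T} :=
  [set t | ~~ `[< range p (f (p t)) >]]%SET.

(** Choosing for each [f s] in the range of [p] an index of it injects those [s]
into [T]. *)
Lemma card_le_add_outside {Y : Type} {S T : finType} (p : T -> Y) (f : S -> Y) :
  injective f ->
  (#|S| <= #|T| + #|[set s : S | ~~ `[< range p (f s) >]]%SET|)%N.
Proof.
move=> f_inj; set O := finset _.
rewrite -(cardsC O) addnC leq_add2r.
have inP s : s \in ~: O -> exists t, p t = f s.
  by rewrite !inE negbK => /asboolP[t _ pt]; exists t.
have [->|[s0 /inP[t0 _]]] := set_0Vmem (~: O); first by rewrite cards0.
have [r rP] : {r : S -> T & forall s, s \in ~: O -> p (r s) = f s}.
  apply: (@choice _ _ (fun s t => s \in ~: O -> p t = f s)) => s.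
  have [/inP[t pt]|sO] := boolP (s \in ~: O); first by exists t.
  by exists t0.
rewrite -(@card_in_imset _ _ r (~: O)); first exact: max_card.
by move=> s s' sO s'O rs; apply: f_inj; rewrite -!rP // rs.
Qed.

(** Only the inverses of the maps of a decomposition are fed to the hypothesis:
they carry the points of the finite set back into disjoint pieces. *)
Lemma Foelner_not_paradoxical {Y : Type} (G : transformation_group Y) :
  (forall (I : finType) (k : I -> Y -> Y), (forall i, tg_set G (k i)) ->
     exists (T : finType) (p : T -> Y),
       injective p /\ (\sum_i #|escape p (k i)| < #|T|)%N) ->
  ~ paradoxical G setT.
Proof.
move=> Foelner [n [m [A [B [g [h [_ _ [trA trB AB0] [Gg Gh] [Eg Eh]]]]]]]].
have [_ _ invG] := tg_axiom G.
have inv f : tg_set G f -> exists f', tg_set G f' /\ cancel f f' /\ cancel f' f.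
  by move=> /invG[f' Gf' ff']; exists f'.
have [g' g'P] := choice (fun i => inv _ (Gg i)).
have [h' h'P] := choice (fun j => inv _ (Gh j)).
pose k (i : 'I_n + 'I_m) := match i with inl i => g' i | inr j => h' j end.
have Gk i : tg_set G (k i) by case: i => i; [case: (g'P i)|case: (h'P i)].
have k_inj i : injective (k i).
  by case: i => i; [have [_ [_]] := g'P i|have [_ [_]] := h'P i]; exact: can_inj.
have [T [p [p_inj small]]] := Foelner _ k Gk.
have coverA t : exists i, A i (g' i (p t)).
  have : [set: Y] (p t) by [].
  rewrite Eg => -[i _ [a Aa <-]]; exists i.
  by have [_ [-> _]] := g'P i.
have coverB t : exists j, B j (h' j (p t)).
  have : [set: Y] (p t) by [].
  rewrite Eh => -[j _ [b Bb <-]]; exists j.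
  by have [_ [-> _]] := h'P j.
have [a aP] := choice coverA; have [b bP] := choice coverB.
(* Each index [t] has two copies: the left one stands for [p t] pulled back into
   a piece [A i], the right one for [p t] pulled back into a piece [B j]. *)
pose piece (s : T + T) : 'I_n + 'I_m :=
  match s with inl t => inl (a t) | inr t => inr (b t) end.
pose base (s : T + T) : T := match s with inl t => t | inr t => t end.
pose pull s := k (piece s) (p (base s)).
have pull_piece s s' : pull s = pull s' -> piece s = piece s'.
  case: s s' => [t|t] [t'|t'] /= e.
  - congr inl; apply: (trA _ _ I I); exists (pull (inl t)).
    by split; [exact: aP|rewrite e; exact: aP].
  - have : (A (a t) `&` B (b t')) (pull (inl t)).
      by split; [exact: aP|rewrite e; exact: bP].
    by rewrite AB0.
  - have : (A (a t') `&` B (b t)) (pull (inr t)).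
      by split; [rewrite e; exact: aP|exact: bP].
    by rewrite AB0.
  - congr inr; apply: (trB _ _ I I); exists (pull (inr t)).
    by split; [exact: bP|rewrite e; exact: bP].
have piece_base_inj : injective (fun s => (piece s, base s)).
  by case=> [t|t] [t'|t'] //= [_ ->].
have pull_inj : injective pull.
  move=> s s' e; apply: piece_base_inj.
  by move: e (pull_piece _ _ e); rewrite /pull => + E; rewrite E => /k_inj /p_inj ->.
have := card_le_add_outside p _ pull_inj.
rewrite card_sum leq_add2l leqNgt => /negP; apply; apply: leq_ltn_trans small.
rewrite -(card_imset _ piece_base_inj).
rewrite (eq_bigr (fun i => \sum_(t in escape p (k i)) 1))%N; last first.
  by move=> i _; rewrite sum1_card.
rewrite pair_big_dep /= sum1_card.
apply/subset_leq_card/fintype.subsetP => _ /imsetP[s + ->].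
by rewrite -[X in _ -> is_true X]/(base s \in escape p (k (piece s))) !inE.
Qed.

Section PaddedWords.
Context {X : finType} (x0 : X).

(** The point [u x0 x0 ...]: the default value of [nth] supplies the tail. *)
Definition pad {l} (u : l.-tuple X) : nat -> X := nth x0 u.

Lemma pad_inj l : injective (@pad l).
Proof.
move=> u v uv; apply/val_inj/(@eq_from_nth _ x0); first by rewrite !size_tuple.
by move=> i _; exact: (congr1 (fun w => w i) uv).
Qed.

Lemma mkseq_nth_padded (u : seq X) n :
  mkseq (nth x0 u) (size u + n) = u ++ nseq n x0.
Proof.
rewrite /mkseq iotaD map_cat -[X in X ++ _]/(mkseq _ _) mkseq_nth; congr cat.
apply: (@eq_from_nth _ x0); first by rewrite size_map size_iota size_nseq.
move=> i; rewrite size_map size_iota => i_n.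
rewrite (nth_map 0%N) ?size_iota // nth_iota // nth_nseq i_n.
by rewrite nth_default // add0n leq_addr.
Qed.

Lemma out_inf_pad (A : automaton X) (q : state A) l (u : l.-tuple X) :
  trivial_state (trans_word q u) ->
  out_inf q (pad u) = pad (out_tuple q u).
Proof.
move=> tr; apply/funext => n.
(* The prefix of length [l + n.+1] is long enough to contain the letter [n]
   and to reach past [u]. *)
have := mkseq_out_inf q (pad u) (size u + n.+1).
rewrite mkseq_nth_padded out_word_cat tr => /(congr1 (fun s => nth x0 s n)).
rewrite nth_mkseq; last by rewrite addnS ltnS leq_addl.
move=> ->; rewrite nth_cat; case: ltnP => // le_n.
by rewrite nth_nseq if_same [RHS]nth_default.
Qed.

(** After a word that reaches a trivial state the padding is copied unchanged, so
only the words counted by [NS] can leave the set of padded words. *)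
Lemma card_escape_le_NS (A : automaton X) (q : state A) l :
  (#|escape (@pad l) (out_inf q)| <= NS q l)%N.
Proof.
apply/subset_leq_card/fintype.subsetP => u; rewrite !inE; apply: contra.
by move=> /asboolP tr; apply/asboolP; rewrite out_inf_pad.
Qed.

Lemma G0_Foelner {R : realType} {I : finType} (k : I -> (nat -> X) -> nat -> X) :
  (forall i, tg_set (G0 R X) (k i)) ->
  exists l, (\sum_i #|escape (@pad l) (k i)| < #|{: l.-tuple X}|)%N.
Proof.
move=> G0k; have X_gt0 : (0 < #|X|)%N by apply/card_gt0P; exists x0.
(* Each of the [#|I|] maps gets an equal share, and the successor makes the total
   strictly smaller than the whole. *)
pose e : R := #|I|.+1%:R^-1.
have e_gt0 : 0 < e by rewrite invr_gt0.
have small i : \forall l \near \oo,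
    #|escape (@pad l) (k i)|%:R <= e * #|X|%:R ^+ l.
  have [A [q [-> /eqoP/(_ _ e_gt0)]]] := G0k i.
  apply: filterS => l; rewrite normr_nat ger0_norm ?exprn_ge0 //.
  by apply: le_trans; rewrite ler_nat card_escape_le_NS.
have [l _ /(_ l (leqnn l)) lP] := filter_forall _ small.
exists l; rewrite -(ltr_nat R) natr_sum card_tuple natrX.
apply: le_lt_trans (ler_sum _ (fun i _ => lP i)) _.
rewrite sumr_const -[ltLHS]mulr_natl mulrA gtr_pMl ?exprn_gt0 ?ltr0n //.
by rewrite /e ltr_pdivrMr // mul1r ltr_nat.
Qed.

End PaddedWords.

Theorem theorem1 (R : realType) (X : finType) (cardX : (1 < #|X|)%N) :
  ~ paradoxical (G0 R X) [set: nat -> X].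
Proof.
have /card_gt0P[x0 _] := ltnW cardX.
apply: Foelner_not_paradoxical => I k /(G0_Foelner x0)[l small].
by exists (l.-tuple X), (pad x0 (l := l)); split=> //; exact: pad_inj.
Qed.
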